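(* Let $k\in\{1,2,3\}$ and $\delta t>0$, and let $(\bar\phi^{n+1},\bar u^{n+1},\bar q^{n+1})$ and $(\phi^{n},u^{n},q^{n})$, $n\ge 0$, be generated by the two-step time stepping scheme (Step 1 and Step 2) described in the context, started from $q^0=E(\phi^0,u^0)$. Then the scheme satisfies the energy dissipation law $$q^{n+1}\le q^n\qquad\text{for all } n\ge 0 .$$ In addition, the quantities $\|\nabla\phi^n\|_0$ and $\|u^n\|_0$ remain bounded for all $n$, i.e. there is a constant $C$, independent of $n$ and of the time step size $\delta t$, such that $\|\nabla\phi^n\|_0\le C$ and $\|u^n\|_0\le C$ for all $n$.
   Context: **Setting.** $\Omega\subset\mathbb{R}^d$, $d\in\{2,3\}$, is a smooth, open, bounded and connected domain, with periodic boundary conditions or homogeneous Neumann boundary conditions. $\|\cdot\|_0$ is the $L^2(\Omega)$ norm. $\tau,\varepsilon,\lambda,K,D,S_1,S_2$ are positive constants. $F(\phi)=\frac{1}{4\varepsilon^2}(\phi^2-1)^2$ and $f=F'$. **Anisotropic coefficient.** $\sigma\in[0,1)$ is the anisotropy strength. In 2D, $m(\nabla\phi)=1+\sigma\cos(\beta\theta)$, where $\beta$ is the number of folds of anisotropy and $\theta$ is the angle of the direction of $\nabla\phi$ ($\theta=\arctan(\phi_y/\phi_x)$). For $\beta=4$ this is $m(\nabla\phi)=1-3\sigma+4\sigma\frac{\phi_x^4+\phi_y^4}{|\nabla\phi|^4}$. In 3D, $m(\nabla\phi)=1-3\sigma+4\sigma\frac{\phi_x^4+\phi_y^4+\phi_z^4}{|\nabla\phi|^4}$.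 $\boldsymbol H(\phi)$ denotes the derivative of $m$ with respect to its vector argument, evaluated at $\nabla\phi$. The expressions $m(\nabla\phi)\nabla\phi$, $m^2(\nabla\phi)\nabla\phi$ and $|\nabla\phi|^2m(\nabla\phi)\boldsymbol H(\phi)$ are taken to be $0$ where $\nabla\phi=0$. **Energy and related quantities.** $$E(\phi,u)=\int_\Omega\Big(\tfrac12|m(\nabla\phi)\nabla\phi|^2+\tfrac{\lambda}{2\varepsilon K}u^2+F(\phi)\Big)d\mathbf{x}+1,$$ $$\frac{\delta E}{\delta\phi}=-\nabla\cdot\big(m^2(\nabla\phi)\nabla\phi+|\nabla\phi|^2m(\nabla\phi)\boldsymbol H(\phi)\big)+f(\phi),$$ $$\frac{\delta E_1}{\delta\phi}=\frac{\delta E}{\delta\phi}+S_1\Delta\phi-\frac{S_2}{\varepsilon^2}\phi,$$ $$\mathcal H(\phi,u)=\frac1\tau\Big\|\frac{\delta E}{\delta\phi}+4\lambda\varepsilon F(\phi)u\Big\|_0^2+\frac{\lambda D}{\varepsilon K}\|\nabla u\|_0^2 .$$ $\frac{\delta E}{\delta\phi}(v)$ and $\frac{\delta E_1}{\delta\phi}(v)$ denote these expressions with $\phi$ replaced by $v$. **BDF-$k$ notation.** For a sequence $\varphi^n$: - $k=1$: $\alpha_1=1$, $A_1(\varphi^n)=\varphi^n$, $B_1(\varphi^n)=\varphi^n$. - $k=2$: $\alpha_2=\frac32$, $A_2(\varphi^n)=2\varphi^n-\frac12\varphi^{n-1}$, $B_2(\varphi^n)=2\varphi^n-\varphi^{n-1}$.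 - $k=3$: $\alpha_3=\frac{11}{6}$, $A_3(\varphi^n)=3\varphi^n-\frac32\varphi^{n-1}+\frac13\varphi^{n-2}$, $B_3(\varphi^n)=3\varphi^n-3\varphi^{n-1}+\varphi^{n-2}$. **Scheme.** The starting values $\phi^{-j},u^{-j}$, $0\le j\le k-1$, are given, and $q^0=E(\phi^0,u^0)$. All functions are real-valued and regular enough that every expression below is well defined, with $E$ and $\mathcal H$ finite. For each $n\ge0$: *Step 1.* Compute $\bar\phi^{n+1},\bar u^{n+1},\bar q^{n+1}$ from $$\tau\frac{\alpha_k\bar\phi^{n+1}-A_k(\phi^n)}{\delta t}-S_1\Delta\bar\phi^{n+1}+\frac{S_2}{\varepsilon^2}\bar\phi^{n+1}=-\frac{\delta E_1}{\delta\phi}(B_k(\phi^n))-4\lambda\varepsilon F(B_k(\phi^n))B_k(u^n),$$ $$\frac{\alpha_k\bar u^{n+1}-A_k(u^n)}{\delta t}-D\Delta\bar u^{n+1}=4\varepsilon^2KF(B_k(\phi^n))\frac{\alpha_k\bar\phi^{n+1}-A_k(\phi^n)}{\delta t},$$ $$\frac{1}{\delta t}(\bar q^{n+1}-q^n)=-\frac{\bar q^{n+1}}{E(\bar\phi^{n+1},\bar u^{n+1})}\mathcal H(\bar\phi^{n+1},\bar u^{n+1}).$$ *Step 2.* Set $$\xi_k^{n+1}=\frac{\bar q^{n+1}}{E(\bar\phi^{n+1},\bar u^{n+1})},\qquad \eta_k^{n+1}=1-(1-\xi_k^{n+1})^{k+1},$$ $$\phi^{n+1}=\eta_k^{n+1}\bar\phi^{n+1},\qquad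 u^{n+1}=\eta_k^{n+1}\bar u^{n+1},$$ $$q^{n+1}=\zeta^{n+1}\bar q^{n+1}+(1-\zeta^{n+1})E(\phi^{n+1},u^{n+1}),$$ where $\zeta^{n+1}\in[0,1]$ is chosen such that $$\frac{q^{n+1}-\bar q^{n+1}}{\delta t}\le\frac{\bar q^{n+1}}{E(\bar\phi^{n+1},\bar u^{n+1})}\mathcal H(\bar\phi^{n+1},\bar u^{n+1}).$$
   Formalization: In 3D the bound on ‖∇φ^n‖_0 is stated only for σ < 3/5: for σ ≥ 3/5, m vanishes in some direction, E does not control ∇φ, and plane waves in that direction violate the bound. The dissipation law and the bound on ‖u^n‖_0 are for all σ in [0,1). *)

(* Defs.v *)
From HB Require Import structures.
From mathcomp Require Import all_boot all_order all_algebra.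
From mathcomp Require Import all_classical all_reals all_analysis.
From mathcomp Require Import measurable_realfun.

Set Implicit Arguments.
Unset Strict Implicit.
Unset Printing Implicit Defensive.

Import Order.TTheory GRing.Theory Num.Theory.
Import numFieldNormedType.Exports.

Local Open Scope classical_set_scope.
Local Open Scope ring_scope.

(** Row vectors carry the Borel sigma-algebra; [lebesgue_rV d] is the
    [d]-fold product of the one-dimensional Lebesgue measure. *)

HB.instance Definition _ (R : realType) (d : nat) :=
  Measurable.copy 'rV[R]_d (g_sigma_algebraType (@open 'rV[R]_d)).

Section borel_rV.
Context {R : realType}.

Lemma open_measurable_rV d (A : set 'rV[R]_d) : open A -> measurable A.
Proof. exact: sub_sigma_algebra. Qed.

Lemma measurable_coord d (i : 'I_d) :
  measurable_fun [set: 'rV[R]_d] (fun x : 'rV[R]_d => x 0 i).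
Proof.
apply: (measurability _ (RGenOpens.measurableE R)).
move=> _ [_ [a [b ->]] <-]; rewrite setTI.
apply: open_measurable_rV.
move/continuousP: (@coord_continuous R 1 d 0 i); apply.
exact: interval_open.
Qed.

Local Definition box d (c : 'rV[rat]_d * nat) : set 'rV[R]_d :=
  [set x | forall i, `|ratr (c.1 0 i) - x 0 i| < c.2.+1%:R^-1].

Local Lemma open_box d (A : set 'rV[R]_d) : open A ->
  A = \bigcup_(c in [set c | @box d c `<=` A]) box c.
Proof.
move=> oA; apply/seteqP; split=> [x Ax|x [c cA]]; last exact: cA.
have /nbhs_ballP[e /= e0 eA] : nbhs x A by exact: open_nbhs_nbhs.
have [n ne] : exists n : nat, n.+1%:R^-1 + n.+1%:R^-1 < e.
  have e20 : 0 < e / 2 by rewrite divr_gt0.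
  have [n _ nP] := near_infty_natSinv_lt (PosNum e20).
  exists n; rewrite [ltRHS](splitr e).
  by apply: ltrD; apply: nP => /=.
have rP i : exists r : rat, `|ratr r - x 0 i| < n.+1%:R^-1.
  have [|r /= /[!in_itv]/= /andP[r1 r2]] :=
      @rat_in_itvoo R (x 0 i - n.+1%:R^-1) (x 0 i + n.+1%:R^-1).
    by rewrite ltrD2l gtrN ?invr_gt0.
  by exists r; rewrite ltr_distl r1 r2.
pose q : 'rV[rat]_d := \row_i sval (cid (rP i)).
have qx i : `|ratr (q 0 i) - x 0 i| < n.+1%:R^-1.
  by rewrite mxE; case: cid.
exists (q, n) => //= y yc; apply: eA; split=> // i j.
rewrite (ord1 i) /ball /=.
apply: (le_lt_trans _ ne); apply: (le_trans (ler_distD (ratr (q 0 j)) _ _)).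
by rewrite lerD// ltW// distrC//; have := yc j; rewrite distrC.
Qed.

Lemma measurable_fun_rV d' (T : measurableType d') d (f : T -> 'rV[R]_d) :
  (forall i, measurable_fun setT (fun t => f t 0 i)) -> measurable_fun setT f.
Proof.
move=> mf; apply: (measurability (@open 'rV[R]_d) erefl).
move=> _ [A oA <-]; rewrite setTI (open_box oA) preimage_bigcup.
rewrite bigcup_mkcond.
apply: countable_bigcupT_measurable => [|c]; first exact: countableP.
case: ifPn => // _.
rewrite (_ : f @^-1` box c =
  \bigcap_(i in [set: 'I_d])
    ((fun t => f t 0 i) @^-1` ball (ratr (c.1 0 i) : R) c.2.+1%:R^-1));
  last by apply/seteqP; split=> t /= tP i; [move=> _|]; apply: tP.
apply: fin_bigcap_measurable; first exact: finite_finset.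
move=> i _; rewrite -[X in measurable X]setTI; apply: mf => //.
exact: measurable_ball.
Qed.

Definition rVcons d (p : R * 'rV[R]_d) : 'rV[R]_d.+1 :=
  \row_i (if unlift ord0 i is Some j then p.2 0 j else p.1).

Local Definition rVuncons d (x : 'rV[R]_d.+1) : R * 'rV[R]_d :=
  (x 0 ord0, \row_j x 0 (lift ord0 j)).

Local Lemma rVconsK d : cancel (@rVcons d) (@rVuncons d).
Proof.
move=> [a x]; rewrite /rVuncons /rVcons mxE unlift_none; congr pair.
by apply/rowP => j; rewrite !mxE liftK.
Qed.

Lemma measurable_rVcons d : measurable_fun setT (@rVcons d).
Proof.
apply: measurable_fun_rV => i.
under eq_fun do rewrite mxE.
case: (unlift ord0 i) => [j|]; last exact: measurable_fst.
exact: (measurableT_comp (measurable_coord j) measurable_snd).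
Qed.

Local Lemma measurable_rVuncons d : measurable_fun setT (@rVuncons d).
Proof.
apply: measurable_fun_pair; first exact: measurable_coord.
apply: measurable_fun_rV => i.
by under eq_fun do rewrite mxE; exact: measurable_coord.
Qed.

Local Lemma sigma_finite_product d1 d2 (T1 : measurableType d1)
    (T2 : measurableType d2) (m1 : {sigma_finite_measure set T1 -> \bar R})
    (m2 : {sigma_finite_measure set T2 -> \bar R}) :
  sigma_finite setT (m1 \x m2)%E.
Proof.
have /sigma_finiteP[F [TF ndF Foo]] := sigma_finiteT m1.
have /sigma_finiteP[G [TG ndG Goo]] := sigma_finiteT m2.
exists (fun n => F n `*` G n).
  rewrite -setXTT TF TG predeqE => -[x y]; split.
    move=> [/= [n _ Fnx] [k _ Gky]]; exists (maxn n k) => //; split.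
    - by move: x Fnx; exact/subsetPset/ndF/leq_maxl.
    - by move: y Gky; exact/subsetPset/ndG/leq_maxr.
  by move=> [n _ []/= ? ?]; split; exists n.
move=> k; have [? ?] := Foo k; have [? ?] := Goo k.
split; first exact: measurableX.
by rewrite product_measure1E// lte_mul_pinfty// ge0_fin_numE.
Qed.

Section consm.
Variables (d : nat) (mu : {sigma_finite_measure set 'rV[R]_d -> \bar R}).

Definition consm : set 'rV[R]_d.+1 -> \bar R :=
  pushforward (@lebesgue_measure R \x mu)%E (@rVcons d).

Local Definition cm : {measure set 'rV[R]_d.+1 -> \bar R} :=
  measure_function_pushforward__canonical__measure_function_Measure
    (@lebesgue_measure R \x mu)%E (@measurable_rVcons d).

Local Lemma consm0 : consm set0 = 0%E. Proof. exact: (measure0 cm). Qed.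

Local Lemma consm_ge0 A : (0 <= consm A)%E. Proof. exact: (measure_ge0 cm). Qed.

Local Lemma consm_sigma_additive : semi_sigma_additive consm.
Proof. exact: (@measure_semi_sigma_additive _ _ _ cm). Qed.

HB.instance Definition _ := isMeasure.Build _ _ _ consm
  consm0 consm_ge0 consm_sigma_additive.

Local Lemma consm_sigma_finite : sigma_finite setT consm.
Proof.
have [F FT Ffin] := sigma_finite_product (@lebesgue_measure R) mu.
exists (fun n => @rVuncons d @^-1` F n).
  by rewrite -preimage_bigcup -FT preimage_setT.
move=> n; have [mF Foo] := Ffin n; split.
  by rewrite -[X in measurable X]setTI; exact: measurable_rVuncons.
rewrite /consm /pushforward -comp_preimage.
by rewrite (_ : _ \o _ = id)//; apply/funext/rVconsK.
Qed.

HB.instance Definition _ :=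
  Measure_isSigmaFinite.Build _ _ _ consm consm_sigma_finite.

End consm.

Fixpoint lebesgue_rV d : {sigma_finite_measure set 'rV[R]_d -> \bar R} :=
  if d is d'.+1 then consm (lebesgue_rV d') else @dirac _ 'rV[R]_0 0 R.

End borel_rV.

Section calculus.
Context {R : realType} {d : nat}.
Implicit Types (v : 'rV[R]_d -> R) (V : 'rV[R]_d -> 'rV[R]_d) (x y : 'rV[R]_d).

(** The norm of ['rV_d] in the library is the sup norm. *)
Definition dotp x y : R := \sum_(i < d) x 0 i * y 0 i.
Definition enorm x : R := Num.sqrt (dotp x x).

Definition partial (i : 'I_d) v : 'rV[R]_d -> R := 'D_(delta_mx 0 i) v.
Definition has_partial (i : 'I_d) v x : Prop := derivable v x (delta_mx 0 i).

Definition grad v x : 'rV[R]_d := \row_i partial i v x.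
Definition lapl v x : R := \sum_(i < d) partial i (partial i v) x.
Definition diver V x : R := \sum_(i < d) partial i (fun y => V y 0 i) x.

Definition has_lapl v x : Prop := forall i, has_partial i (partial i v) x.
Definition has_diver V x : Prop :=
  forall i, has_partial i (fun y => V y 0 i) x.

Definition smooth v : Prop :=
  forall (s : seq 'I_d) x, differentiable (foldr partial v s) x.

End calculus.

Section domains.
Context {R : realType} {d : nat}.
Implicit Types (Omega : set 'rV[R]_d) (v : 'rV[R]_d -> R) (x : 'rV[R]_d).

Definition boundary Omega : set 'rV[R]_d := closure Omega `\` interior Omega.

Definition local_defining Omega x (rho : 'rV[R]_d -> R) : Prop :=
  [/\ smooth rho, grad rho x != 0 &
      \forall y \near x, Omega y <-> rho y < 0].

Definition smooth_boundary Omega : Prop :=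
  forall x, boundary Omega x -> exists rho, local_defining Omega x rho.

Definition outer_normal Omega x (nu : 'rV[R]_d) : Prop :=
  boundary Omega x /\
  exists rho, local_defining Omega x rho /\
    nu = (enorm (grad rho x))^-1 *: grad rho x.

(** [Periodic a L] stands for the box [prod_i (a_i, a_i + L_i)] with opposite
    faces identified, i.e. the smooth flat torus. *)
Inductive boundary_condition :=
  | Periodic of 'rV[R]_d & 'rV[R]_d
  | Neumann.

Definition valid_domain (bc : boundary_condition) Omega : Prop :=
  match bc with
  | Periodic a L =>
      (forall i, 0 < L 0 i) /\
      Omega = [set x | forall i, a 0 i < x 0 i < a 0 i + L 0 i]
  | Neumann =>
      [/\ open Omega, bounded_set Omega, connected Omega &
          smooth_boundary Omega]
  end.

(** In the periodic case functions are periodic functions on the whole space,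
    so that regularity also holds across the faces of the box. *)
Definition regularity_domain (bc : boundary_condition) Omega :
    set 'rV[R]_d :=
  if bc is Periodic _ _ then setT else Omega.

(** The homogeneous Neumann condition is the vanishing of the limit, from
    inside [Omega], of the derivative in the direction of the normal. *)
Definition satisfies_bc (bc : boundary_condition) Omega v : Prop :=
  match bc with
  | Periodic _ L => forall x i, v (x + L 0 i *: delta_mx 0 i) = v x
  | Neumann => forall x nu, outer_normal Omega x nu ->
      dotp (grad v y) nu @[y --> within Omega (nbhs x)] --> (0 : R)
  end.

Definition ae_in Omega (Q : 'rV[R]_d -> Prop) : Prop :=
  {ae lebesgue_rV d, forall x, Omega x -> Q x}.

(** Continuously differentiable, with a Laplacian almost everywhere: weak
    enough for strong solutions in [W^{2,p}], [p > d], of the elliptic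
    problems of the scheme. Full C^2 regularity would be too strong, because
    the anisotropic flux is in general not differentiable where the gradient
    vanishes. *)
Definition regular (bc : boundary_condition) Omega v : Prop :=
  [/\ forall x, regularity_domain bc Omega x -> differentiable v x,
      forall x, regularity_domain bc Omega x -> {for x, continuous (grad v)},
      ae_in Omega (has_lapl v) &
      satisfies_bc bc Omega v].

Definition norm0 Omega v : \bar R :=
  sqrte (\int[lebesgue_rV d]_(x in Omega) (v x ^+ 2)%:E).

Definition L2 Omega v : Prop :=
  measurable_fun Omega v /\ (norm0 Omega v < +oo)%E.

End domains.
Arguments Periodic {R d}.
Arguments Neumann {R d}.

Record params (R : realType) := Params {
  tau : R; eps : R; lam : R; Kcst : R; Dcst : R; S1 : R; S2 : R;
  sigma : R;
  beta : nat (* number of folds, used in dimension 2 only *)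
}.

Definition valid_params (R : realType) (P : params R) : Prop :=
  [/\ [/\ 0 < tau P, 0 < eps P & 0 < lam P],
      [/\ 0 < Kcst P, 0 < Dcst P, 0 < S1 P & 0 < S2 P],
      0 <= sigma P < 1 &
      (0 < beta P)%N].

Section anisotropy.
Context {R : realType}.

(** Polar angle in (-pi, pi]. [atan (p_y / p_x)] gives it only up to a multiple
    of pi, which is not enough for [cos (beta * angle)] when [beta] is odd. *)
Definition angle (p : 'rV[R]_2) : R :=
  if 0 <= p 0 1 then acos (p 0 0 / enorm p) else - acos (p 0 0 / enorm p).

Definition aniso2 (sg : R) (b : nat) (p : 'rV[R]_2) : R :=
  1 + sg * cos (b%:R * angle p).

(** The minimum over nonzero [p] is [1 - 5 / 3 * sg] (at [p = (1, 1, 1)]), which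
    is positive only for [sg < 3 / 5]; for larger [sg] the energy does not
    control the gradient. *)
Definition aniso3 (sg : R) (p : 'rV[R]_3) : R :=
  1 - 3 * sg + 4 * sg * ((\sum_(i < 3) p 0 i ^+ 4) / enorm p ^+ 4).

(** Only [d = 2] and [d = 3] are meaningful. *)
Definition aniso (P : params R) (d : nat) : 'rV[R]_d -> R :=
  match d with
  | 2 => aniso2 (sigma P) (beta P)
  | 3 => aniso3 (sigma P)
  | _ => fun=> 1
  end.

(** The value of [aniso P 0] is arbitrary: it only occurs multiplied by the zero
    vector or by [enorm 0 ^+ 2 = 0], which yields the convention that these
    products vanish where the gradient does. *)
Definition aniso_grad (P : params R) (d : nat) (p : 'rV[R]_d) : 'rV[R]_d :=
  grad (@aniso P d) p.

Definition flux (P : params R) (d : nat) (p : 'rV[R]_d) : 'rV[R]_d :=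
  (aniso P p ^+ 2) *: p + (enorm p ^+ 2 * aniso P p) *: aniso_grad P p.

End anisotropy.

Section energy.
Context {R : realType} {d : nat} (P : params R) (Omega : set 'rV[R]_d).
Implicit Types phi u v : 'rV[R]_d -> R.

Definition Fpot (s : R) : R := (s ^+ 2 - 1) ^+ 2 / (4 * eps P ^+ 2).
Definition fpot : R -> R := derive1 Fpot.

Definition energy_density phi u (x : 'rV[R]_d) : R :=
  enorm (aniso P (grad phi x) *: grad phi x) ^+ 2 / 2
  + lam P / (2 * eps P * Kcst P) * u x ^+ 2 + Fpot (phi x).

Definition finite_energy phi u : Prop :=
  (lebesgue_rV d).-integrable Omega (EFin \o energy_density phi u).

Definition energy phi u : R :=
  (\int[lebesgue_rV d]_(x in Omega) energy_density phi u x)%R + 1.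

Definition flux_of v (x : 'rV[R]_d) : 'rV[R]_d := flux P (grad v x).

Definition dE v (x : 'rV[R]_d) : R := - diver (flux_of v) x + fpot (v x).

Definition dE1 v (x : 'rV[R]_d) : R :=
  dE v x + S1 P * lapl v x - S2 P / eps P ^+ 2 * v x.

Definition residual phi u (x : 'rV[R]_d) : R :=
  dE phi x + 4 * lam P * eps P * Fpot (phi x) * u x.

Definition finite_dissipation phi u : Prop :=
  L2 Omega (residual phi u) /\ L2 Omega (enorm \o grad u).

Definition dissipation phi u : R :=
  (tau P)^-1 * fine (norm0 Omega (residual phi u)) ^+ 2
  + lam P * Dcst P / (eps P * Kcst P)
    * fine (norm0 Omega (enorm \o grad u)) ^+ 2.

End energy.

Section bdf.
Context {R : realType} {T : Type}.

(** Sequences are indexed by [int] since the starting values of the [k]-step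
    method are those of index [0, -1, ..., 1 - k]. *)
Implicit Types (k : nat) (phi : int -> T -> R) (n : int) (x : T).

Definition alpha k : R :=
  match k with 1 => 1 | 2 => 3 / 2 | 3 => 11 / 6 | _ => 0 end.

Definition A_ k phi n x : R :=
  match k with
  | 1 => phi n x
  | 2 => 2 * phi n x - 1 / 2 * phi (n - 1) x
  | 3 => 3 * phi n x - 3 / 2 * phi (n - 1) x + 1 / 3 * phi (n - 2) x
  | _ => 0
  end.

Definition B_ k phi n x : R :=
  match k with
  | 1 => phi n x
  | 2 => 2 * phi n x - phi (n - 1) x
  | 3 => 3 * phi n x - 3 * phi (n - 1) x + phi (n - 2) x
  | _ => 0
  end.

End bdf.

Section scheme.
Context {R : realType} {d : nat}.
Variables (P : params R) (bc : @boundary_condition R d) (Omega : set 'rV[R]_d).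
Variables (k : nat) (dt : R).

(** [phib n.+1], [ub n.+1], [qb n.+1] are the intermediate (barred) values;
    the values at index [0] of these three sequences and of [zeta] are unused. *)
Variables (phi u : int -> 'rV[R]_d -> R) (q : nat -> R).
Variables (phib ub : nat -> 'rV[R]_d -> R) (qb zeta : nat -> R).

Definition admissible : Prop :=
  [/\ forall j : int, 1 - k%:Z <= j ->
        regular bc Omega (phi j) /\ regular bc Omega (u j),
      forall n : nat, regular bc Omega (phib n.+1) /\ regular bc Omega (ub n.+1),
      forall n : nat, finite_energy P Omega (phi n) (u n),
      forall n : nat, finite_energy P Omega (phib n.+1) (ub n.+1) /\
                      finite_dissipation P Omega (phib n.+1) (ub n.+1) &
      forall n : nat, ae_in Omega (has_diver (flux_of P (B_ k phi n))) /\
                      ae_in Omega (has_diver (flux_of P (phib n.+1)))].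

Definition step1 (n : nat) : Prop :=
  [/\ ae_in Omega (fun x =>
        tau P * ((alpha k * phib n.+1 x - A_ k phi n x) / dt)
          - S1 P * lapl (phib n.+1) x + S2 P / eps P ^+ 2 * phib n.+1 x
        = - dE1 P (B_ k phi n) x
          - 4 * lam P * eps P * Fpot P (B_ k phi n x) * B_ k u n x),
      ae_in Omega (fun x =>
        (alpha k * ub n.+1 x - A_ k u n x) / dt - Dcst P * lapl (ub n.+1) x
        = 4 * eps P ^+ 2 * Kcst P * Fpot P (B_ k phi n x)
          * ((alpha k * phib n.+1 x - A_ k phi n x) / dt)) &
      dt^-1 * (qb n.+1 - q n)
        = - (qb n.+1 / energy P Omega (phib n.+1) (ub n.+1))
          * dissipation P Omega (phib n.+1) (ub n.+1)].

Definition xi (n : nat) : R := qb n / energy P Omega (phib n) (ub n).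
Definition eta (n : nat) : R := 1 - (1 - xi n) ^+ k.+1.

Definition step2 (n : nat) : Prop :=
  [/\ forall x, phi n.+1 x = eta n.+1 * phib n.+1 x,
      forall x, u n.+1 x = eta n.+1 * ub n.+1 x,
      q n.+1 = zeta n.+1 * qb n.+1
               + (1 - zeta n.+1) * energy P Omega (phi n.+1) (u n.+1),
      0 <= zeta n.+1 <= 1 &
      (q n.+1 - qb n.+1) / dt
        <= qb n.+1 / energy P Omega (phib n.+1) (ub n.+1)
           * dissipation P Omega (phib n.+1) (ub n.+1)].

Definition generated_by_scheme : Prop :=
  [/\ admissible, q 0%N = energy P Omega (phi 0) (u 0) &
      forall n : nat, step1 n /\ step2 n].

End scheme.

(* Main.v *)
Require Import Defs.
From mathcomp Require Import all_boot all_order all_algebra.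
From mathcomp Require Import all_classical all_reals all_analysis.
From mathcomp Require Import ring lra.

Import Order.TTheory GRing.Theory Num.Theory.
Import numFieldNormedType.Exports.

Set Implicit Arguments.
Unset Strict Implicit.
Unset Printing Implicit Defensive.

Local Open Scope classical_set_scope.
Local Open Scope ring_scope.

(** Adding the equation for [qb] to the inequality that selects [zeta] gives
    [q n.+1 <= q n]; since [qb] solves a linear equation with nonnegative
    coefficients, [0 <= qb n.+1 <= q n <= M] where [M] is the initial energy.
    Hence [0 <= xi <= M / E] with [E >= 1] the intermediate energy, and
    [eta = 1 - (1 - xi) ^+ k.+1] is divisible by [xi], so [|eta| <= G M / E]
    with [G] depending on [M] and [k] only. The squared norms of the intermediate
    solution are [O(E)], so those of its multiple by [eta] are
    [O(G ^+ 2 * M ^+ 2 / E)]. *)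

(** * Monotonicity of the integral and a geometric-sum estimate *)

(** The integral of a nonnegative function is a supremum over simple functions below it, and those
    below [f] are below [g]. It serves for norms of functions that are not assumed measurable. *)
Lemma ge0_le_integral_nonmeasurable (dsp : measure_display)
    (T : measurableType dsp) (R : realType)
    (mu : {measure set T -> \bar R}) (D : set T) (f g : T -> \bar R) :
  (forall x, D x -> (0 <= f x)%E) -> (forall x, D x -> (f x <= g x)%E) ->
  (\int[mu]_(x in D) f x <= \int[mu]_(x in D) g x)%E.
Proof.
move=> f0 fg; have g0 x : D x -> (0 <= g x)%E.
  by move=> Dx; exact: le_trans (f0 _ Dx) (fg _ Dx).
rewrite (ge0_integralE _ f0) (ge0_integralE _ g0).
apply: ereal_sup_le => _ [h /= hf <-]; exists h => // x.
apply: le_trans (hf x) _.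
by rewrite !patchE; case: ifPn => // /set_mem /fg.
Qed.

(** Factoring the difference of powers pulls out one factor [x] and leaves a geometric sum in
    [1 - x], where [|1 - x| <= 1 + M]. *)
Lemma one_sub_exp_le (R : realDomainType) (M x : R) (n : nat) :
  0 <= x <= M ->
  `|1 - (1 - x) ^+ n| <= x * \sum_(i < n) (1 + M) ^+ i.
Proof.
move=> /andP[x0 xM].
have -> : 1 - (1 - x) ^+ n = x * \sum_(i < n) (1 - x) ^+ i.
  by rewrite -opprB subrX1; ring.
rewrite normrM (ger0_norm x0) ler_wpM2l// (le_trans (ler_norm_sum _ _ _))//.
apply: ler_sum => i _; rewrite normrX lerXn2r ?nnegrE//; first by lra.
by rewrite ler_norml; lra.
Qed.

(** * Homogeneity of the Euclidean norm and of the gradient *)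

Section euclidean_norm.
Context {R : realType} {d : nat}.
Implicit Types (p : 'rV[R]_d) (a : R).

Lemma enorm_sqr p : enorm p ^+ 2 = \sum_(i < d) p 0 i ^+ 2.
Proof.
rewrite /enorm sqr_sqrtr /dotp; last by apply: sumr_ge0 => i _; exact: sqr_ge0.
by apply: eq_bigr => i _; rewrite expr2.
Qed.

Lemma enormZ_sqr a p : enorm (a *: p) ^+ 2 = a ^+ 2 * enorm p ^+ 2.
Proof.
rewrite !enorm_sqr mulr_sumr.
by apply: eq_bigr => i _; rewrite mxE exprMn.
Qed.

Lemma gradZ a (v : 'rV[R]_d -> R) x : differentiable v x ->
  grad (fun y => a * v y) x = a *: grad v x.
Proof.
move=> dv; apply/rowP => i; rewrite !mxE /partial.
by rewrite -[RHS]deriveZ//; exact: diff_derivable.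
Qed.

End euclidean_norm.

(** * Coercivity of the anisotropic gradient term *)

Section coercivity.
Context {R : realType}.

Lemma aniso2_ge (sg : R) b p : 0 <= sg -> 1 - sg <= aniso2 sg b p.
Proof.
move=> sg0; rewrite /aniso2; have := cos_geN1 (b%:R * angle p); nra.
Qed.

Lemma aniso3_ge (sg : R) p : 0 <= sg -> enorm p ^+ 2 != 0 ->
  1 - 5 / 3 * sg <= aniso3 sg p.
Proof.
move=> sg0 p0.
have : 1 / 3 <= (\sum_(i < 3) p 0 i ^+ 4) / enorm p ^+ 4.
  have e0 : 0 < enorm p ^+ 2 by rewrite lt_def p0 sqr_ge0.
  have -> : enorm p ^+ 4 = (enorm p ^+ 2) ^+ 2 by ring.
  rewrite ler_pdivlMr; last exact: exprn_gt0.
  rewrite enorm_sqr !big_ord_recl !big_ord0.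
  move: (p 0 _) (p 0 _) (p 0 _) => a b c.
  have := sqr_ge0 (a ^+ 2 - b ^+ 2); have := sqr_ge0 (a ^+ 2 - c ^+ 2).
  have := sqr_ge0 (b ^+ 2 - c ^+ 2); lra.
rewrite -subr_ge0 => /(mulr_ge0 sg0); rewrite /aniso3; lra.
Qed.

(** A positive lower bound on the anisotropy, squared and halved, is the constant. The condition on
    [sigma] stands after the existential so that [c] can enter a constant that also serves the
    unconditional bound on [u]. *)
Lemma aniso_coercive (d : nat) (P : params R) :
    d = 2%N \/ d = 3%N -> valid_params P ->
  exists2 c : R, 0 < c & ((d = 3%N -> sigma P < 3 / 5) ->
    forall p : 'rV[R]_d,
      c * enorm p ^+ 2 <= enorm (aniso P p *: p) ^+ 2 / 2).
Proof.
(* Here [e] is the squared norm of the vector; the case [e = 0] is separate because in 3D the bound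
   on [m] holds only away from the zero vector. *)
have square_le (c m e : R) : 0 <= c -> 0 <= e -> (e != 0 -> c <= m) ->
    c ^+ 2 / 2 * e <= m ^+ 2 * e / 2.
  move=> c0 e0; have [->|_ /(_ isT) cm] := eqVneq e 0; first by lra.
  have : c ^+ 2 <= m ^+ 2 by rewrite lerXn2r ?nnegrE//; lra.
  nra.
move=> + [_ _ /andP[sg0 sg1] _] => -[->|->].
  exists ((1 - sigma P) ^+ 2 / 2); first by rewrite divr_gt0// exprn_gt0; lra.
  move=> _ p; rewrite enormZ_sqr; apply: square_le; rewrite ?sqr_ge0//.
    by lra.
  by move=> _; exact: aniso2_ge.
have [sg35|sg35] := ltP (sigma P) (3 / 5); last first.
  (* A dummy constant: the condition on [sigma] fails in this case. *)
  by exists 1 => // /(_ erefl); lra.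
exists ((1 - 5 / 3 * sigma P) ^+ 2 / 2).
  by rewrite divr_gt0// exprn_gt0//; lra.
move=> _ p; rewrite enormZ_sqr; apply: square_le; rewrite ?sqr_ge0//.
  by lra.
exact: aniso3_ge.
Qed.

End coercivity.

(** * Lower bounds on the energy and the norms it controls *)

Section energy_bounds.
Context {R : realType} {d : nat}.
Variables (P : params R) (bc : @boundary_condition R d) (Omega : set 'rV[R]_d).
Hypotheses (hP : valid_params P) (hOmega : valid_domain bc Omega).
Implicit Types phi u v : 'rV[R]_d -> R.

Lemma measurable_domain : measurable Omega.
Proof.
case: bc hOmega => [a L [_ OE]|[oO _ _ _]]; last exact: open_measurable_rV.
have -> : Omega = \bigcap_(i in [set: 'I_d])
    ((fun x : 'rV[R]_d => x 0 i) @^-1` `]a 0 i, a 0 i + L 0 i[).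
  rewrite OE; apply/seteqP; split=> x /= xO i => [_|].
    by rewrite /= in_itv/=; exact: xO.
  by have := xO i I; rewrite /= in_itv.
apply: fin_bigcap_measurable; first exact: finite_finset.
by move=> i _; rewrite -[X in measurable X]setTI; exact: measurable_coord.
Qed.

Lemma regular_differentiable v x :
  regular bc Omega v -> Omega x -> differentiable v x.
Proof. by move=> [dv _ _ _] Ox; apply: dv; case: bc. Qed.

Lemma u_weight_gt0 : 0 < lam P / (2 * eps P * Kcst P).
Proof. by case: hP => -[_ e l] [K _ _ _] _ _; rewrite divr_gt0// !mulr_gt0. Qed.

Lemma Fpot_ge0 (s : R) : 0 <= Fpot P s.
Proof.
rewrite /Fpot; apply: divr_ge0; first exact: sqr_ge0.
by apply: mulr_ge0 => //; exact: sqr_ge0.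
Qed.

Lemma energy_density_ge_grad phi u x :
  enorm (aniso P (grad phi x) *: grad phi x) ^+ 2 / 2
    <= energy_density P phi u x.
Proof.
rewrite /energy_density -addrA lerDl addr_ge0 ?Fpot_ge0//.
by rewrite mulr_ge0 ?sqr_ge0// ltW// u_weight_gt0.
Qed.

Lemma energy_density_ge_u phi u x :
  lam P / (2 * eps P * Kcst P) * u x ^+ 2 <= energy_density P phi u x.
Proof.
rewrite /energy_density addrAC lerDr addr_ge0 ?Fpot_ge0//.
by rewrite divr_ge0 ?sqr_ge0.
Qed.

Lemma energy_density_ge0 phi u x : 0 <= energy_density P phi u x.
Proof.
apply: le_trans (energy_density_ge_u phi u x).
by rewrite mulr_ge0 ?sqr_ge0// ltW// u_weight_gt0.
Qed.

(** The summand 1 in the energy keeps the denominator of [xi] away from zero. *)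
Lemma energy_ge1 phi u : 1 <= energy P Omega phi u.
Proof.
by rewrite /energy lerDr Rintegral_ge0// => x _; exact: energy_density_ge0.
Qed.

Lemma dissipation_ge0 phi u : 0 <= dissipation P Omega phi u.
Proof.
case: hP => -[t e l] [K D _ _] _ _.
rewrite /dissipation addr_ge0// mulr_ge0 ?sqr_ge0 ?invr_ge0 ?(ltW t)//.
by rewrite divr_ge0// mulr_ge0// ltW.
Qed.

Lemma norm0_le_energy phi u v (a : R) :
  finite_energy P Omega phi u -> 0 <= a ->
  (forall x, Omega x -> v x ^+ 2 <= a * energy_density P phi u x) ->
  (norm0 Omega v <= (Num.sqrt (a * energy P Omega phi u))%:E)%E.
Proof.
move=> fE a0 vE; have mO := measurable_domain.
have aE0 : 0 <= a * energy P Omega phi u.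
  by rewrite mulr_ge0// (le_trans ler01)// energy_ge1.
change (norm0 Omega v <= sqrte (a * energy P Omega phi u)%:E)%E.
rewrite /norm0 lee_sqrt ?lee_fin//.
apply: (@le_trans _ _ (\int[lebesgue_rV d]_(x in Omega)
    (a%:E * (energy_density P phi u x)%:E)))%E.
  apply: ge0_le_integral_nonmeasurable => x Ox; first by rewrite lee_fin sqr_ge0.
  by rewrite -EFinM lee_fin vE.
rewrite integralZl// EFinM lee_wpmul2l ?lee_fin//.
(* Integrability makes the integral finite, so [fine] returns its true value; the summand 1 only
   enlarges the right-hand side. *)
rewrite /energy /Rintegral EFinD fineK ?integrable_fin_num// leeDl// lee_fin.
Qed.

End energy_bounds.

(** * Dissipation and uniform bounds along the scheme *)

Section scheme.
Context {R : realType} {d : nat}.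
Variables (P : params R) (bc : @boundary_condition R d) (Omega : set 'rV[R]_d).
Hypotheses (hP : valid_params P) (hOmega : valid_domain bc Omega).
Variables (k : nat) (dt : R).
Variables (phi u : int -> 'rV[R]_d -> R) (q : nat -> R).
Variables (phib ub : nat -> 'rV[R]_d -> R) (qb zeta : nat -> R).
Hypotheses (dt0 : 0 < dt)
  (hS : generated_by_scheme P bc Omega k dt phi u q phib ub qb zeta).

Let Eb n := energy P Omega (phib n) (ub n).

Lemma scheme_dissipative n : q n.+1 <= q n.
Proof.
case: hS => _ _ /(_ n)[[_ _ e1] [_ _ _ _]].
rewrite ler_pdivrMr// => e2.
have : qb n.+1 - q n = dt * (dt^-1 * (qb n.+1 - q n)).
  by rewrite mulrA divff ?mul1r// gt_eqF.
by rewrite e1; lra.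
Qed.

Lemma qb_between n : 0 <= q n -> 0 <= qb n.+1 <= q n.
Proof.
move=> q0; case: hS => _ _ /(_ n)[[_ _ e1] _].
(* With this [t], the implicit equation for [qb] reads [qb n.+1 * (1 + t) = q n]. *)
set t := dt * (dissipation P Omega (phib n.+1) (ub n.+1) / Eb n.+1).
have t0 : 0 <= t.
  rewrite mulr_ge0 ?(ltW dt0)// divr_ge0 ?dissipation_ge0//.
  by rewrite (le_trans ler01)// energy_ge1.
have qE : qb n.+1 * (1 + t) = q n.
  have : qb n.+1 - q n = dt * (dt^-1 * (qb n.+1 - q n)).
    by rewrite mulrA divff ?mul1r// gt_eqF.
  by rewrite e1 /t /Eb => h; apply/eqP; rewrite -subr_eq0; apply/eqP; lra.
have qb0 : 0 <= qb n.+1.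
  by rewrite -(@pmulr_lge0 _ (1 + t)) ?qE//; lra.
by rewrite qb0 /= -qE; nra.
Qed.

(** The upper bound follows from dissipation; the lower one because [q n.+1] is a convex combination
    of [qb n.+1], nonnegative by induction, and an energy. *)
Lemma q_between n : 0 <= q n <= energy P Omega (phi 0) (u 0).
Proof.
elim: n => [|n /andP[q0 qM]].
  by case: hS => _ -> _; rewrite lexx (le_trans ler01)// energy_ge1.
rewrite (le_trans (scheme_dissipative n) qM) andbT.
case: hS => _ _ /(_ n)[_ [_ _ -> /andP[z0 z1] _]].
have /andP[qb0 _] := qb_between q0.
by rewrite addr_ge0// mulr_ge0 ?subr_ge0// (le_trans ler01)// energy_ge1.
Qed.

Let M := energy P Omega (phi 0) (u 0).
Let G := \sum_(i < k.+1) (1 + M) ^+ i.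

Lemma eta_energy_le n :
  eta P Omega k phib ub qb n.+1 ^+ 2 * Eb n.+1 <= G ^+ 2 * M ^+ 2.
Proof.
have /andP[q0 qM] := q_between n; have /andP[qb0 qbq] := qb_between q0.
have E1 : 1 <= Eb n.+1 by exact: energy_ge1.
have E0 : 0 < Eb n.+1 by lra.
set x := xi P Omega phib ub qb n.+1.
have xE : x * Eb n.+1 = qb n.+1 by rewrite /x /xi divfK// gt_eqF.
have x0 : 0 <= x by rewrite divr_ge0// ltW.
have qbM : qb n.+1 <= M by exact: le_trans qM.
have xM : x <= qb n.+1 by rewrite -xE ler_peMr.
have G0 : 0 <= G by apply: sumr_ge0 => i _; rewrite exprn_ge0//; lra.
have etaG : `|eta P Omega k phib ub qb n.+1| <= x * G.
  by apply: one_sub_exp_le; rewrite x0 (le_trans xM).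
rewrite -real_normK ?num_real//.
apply: (@le_trans _ _ ((x * G) ^+ 2 * Eb n.+1)).
  by rewrite ler_wpM2r ?(ltW E0)// lerXn2r ?nnegrE// mulr_ge0.
(* Of the two factors [x], one absorbs the energy, since [x * Eb n.+1 = qb n.+1], and the other is
   at most [M]. *)
rewrite (_ : _ * _ = G ^+ 2 * (x * (x * Eb n.+1))); last by ring.
rewrite xE ler_wpM2l ?sqr_ge0// expr2.
by apply: ler_pM => //; exact: le_trans qbM.
Qed.

(** [N] stands for either the gradient norm of the first function or the second function itself: all
    that matters is that its square is dominated by the energy density and is homogeneous of degree
    two. *)
Lemma norm0_scheme_le (N : ('rV[R]_d -> R) -> ('rV[R]_d -> R) -> 'rV[R]_d -> R)
    (c : R) (n : nat) : 0 < c ->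
  (forall v w x, c * N v w x ^+ 2 <= energy_density P v w x) ->
  (forall a v w x, regular bc Omega v -> regular bc Omega w -> Omega x ->
    N (fun y => a * v y) (fun y => a * w y) x ^+ 2 = a ^+ 2 * N v w x ^+ 2) ->
  (norm0 Omega (N (phi n) (u n))
    <= (Num.sqrt (c^-1 * (M + G ^+ 2 * M ^+ 2)))%:E)%E.
Proof.
move=> c0 Nc Nhom; case: hS => -[_ rb fE fEb _] _ hstep.
have M0 : 0 <= M by rewrite (le_trans ler01)// energy_ge1.
have Nle v w x : N v w x ^+ 2 <= c^-1 * energy_density P v w x.
  by rewrite mulrC ler_pdivlMr// mulrC.
(* The initial value is no rescaled intermediate solution; its energy is [M], which accounts for the
   first summand of the bound. Later steps use the second. *)
case: n => [|n].
  apply: le_trans (norm0_le_energy hP hOmega (fE 0%N) _ (fun x _ => Nle _ _ x)) _.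
    by rewrite invr_ge0 ltW.
  rewrite lee_fin ler_wsqrtr// ler_wpM2l ?invr_ge0 ?(ltW c0)//.
  by rewrite lerDl mulr_ge0 ?sqr_ge0.
set e := eta P Omega k phib ub qb n.+1.
have [_ [phiE uE _ _ _]] := hstep n; have [rphib rub] := rb n.
have -> : phi n.+1 = (fun y => e * phib n.+1 y) by exact/funext.
have -> : u n.+1 = (fun y => e * ub n.+1 y) by exact/funext.
have [fEbn _] := fEb n.
have a0 : 0 <= e ^+ 2 / c by rewrite divr_ge0 ?sqr_ge0// ltW.
apply: le_trans (norm0_le_energy hP hOmega fEbn a0 _) _ => [x Ox|].
  by rewrite Nhom// -mulrA ler_wpM2l ?sqr_ge0.
rewrite lee_fin ler_wsqrtr// mulrAC mulrC ler_wpM2l ?invr_ge0 ?(ltW c0)//.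
by rewrite (le_trans (eta_energy_le n))// lerDr.
Qed.

End scheme.

(** * Energy dissipation, and bounds uniform in [n] and [dt] *)

Theorem theorem3p1 (R : realType) (d : nat) (P : params R)
    (bc : @boundary_condition R d) (Omega : set 'rV[R]_d) (k : nat)
    (hd : d = 2%N \/ d = 3%N) (hP : valid_params P)
    (hOmega : valid_domain bc Omega) (hk : (1 <= k <= 3)%N) :
  (forall (dt : R) (phi u : int -> 'rV[R]_d -> R) (q : nat -> R)
      (phib ub : nat -> 'rV[R]_d -> R) (qb zeta : nat -> R),
    0 < dt ->
    generated_by_scheme P bc Omega k dt phi u q phib ub qb zeta ->
    forall n : nat, q n.+1 <= q n)
  /\
  (forall phi0 u0 : 'rV[R]_d -> R, exists C : R,
    forall (dt : R) (phi u : int -> 'rV[R]_d -> R) (q : nat -> R)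
      (phib ub : nat -> 'rV[R]_d -> R) (qb zeta : nat -> R),
    0 < dt ->
    generated_by_scheme P bc Omega k dt phi u q phib ub qb zeta ->
    phi 0 = phi0 -> u 0 = u0 ->
    forall n : nat,
      ((d = 3%N -> sigma P < 3 / 5) ->
        (norm0 Omega (fun x => enorm (grad (phi n%:Z) x)) <= C%:E)%E) /\
      (norm0 Omega (u n%:Z) <= C%:E)%E).
Proof.
split=> [dt phi u q phib ub qb zeta dt0 hS n|phi0 u0].
  exact: scheme_dissipative hS n.
have [c c0 cP] := aniso_coercive hd hP.
(* The constant is built from the initial energy, [k], [c] and [cu], all fixed before [dt] and the
   sequences; adding the two square roots covers both norms. *)
pose M := energy P Omega phi0 u0.
pose B := M + (\sum_(i < k.+1) (1 + M) ^+ i) ^+ 2 * M ^+ 2.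
pose cu := lam P / (2 * eps P * Kcst P).
exists (Num.sqrt (c^-1 * B) + Num.sqrt (cu^-1 * B)).
move=> dt phi u q phib ub qb zeta dt0 hS phi0E u0E n; split=> [sg35|].
  apply: (@le_trans _ _ (Num.sqrt (c^-1 * B))%:E); last first.
    by rewrite lee_fin lerDl sqrtr_ge0.
  rewrite /B /M -phi0E -u0E.
  apply: (norm0_scheme_le hP hOmega dt0 hS
    (N := fun v _ x => enorm (grad v x))) => // [v w x|a v w x rv _ Ox].
    exact: le_trans (cP sg35 _) (energy_density_ge_grad hP _ _ _).
  by rewrite gradZ ?enormZ_sqr//; exact: regular_differentiable rv Ox.
apply: (@le_trans _ _ (Num.sqrt (cu^-1 * B))%:E); last first.
  by rewrite lee_fin lerDr sqrtr_ge0.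
rewrite /B /M -phi0E -u0E.
apply: (norm0_scheme_le hP hOmega dt0 hS (N := fun _ w => w)) => //.
- exact: u_weight_gt0.
- by move=> v w x; exact: energy_density_ge_u.
- by move=> a v w x _ _ _; rewrite exprMn.
Qed.
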